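(* Let $d\ge 2$ and let the eigenspaces of the edge graph of the cross-polytope $\Diamond_d$ (the cocktail party graph) be in frequency order. Then the graph has exactly $2^d$ minimal positively weighted extremal designs; each of them consists of $d$ vertices and corresponds to a facet of $\Diamond_d$ (i.e. these designs are the vertex sets of the facets of $\Diamond_d$). Each of these designs is combinatorial.
   Context: $\Diamond_d=\operatorname{conv}\{\pm e_i: i\in[d]\}\subset\mathbb{R}^d$. Its edge graph is the complete multipartite graph $K_{2,\dots,2}$ on the $2d$ vertices $\pm e_i$, in which every two vertices except antipodal pairs $e_i,-e_i$ are adjacent; it is $2(d-1)$-regular. For a connected $\delta$-regular graph $G$ on $n$ vertices with adjacency matrix $A$, eigenvalues and eigenspaces mean those of $\frac1\delta A$. The eigenspace $\Lambda_1=\operatorname{span}\{\mathbb{1}\}$ is always ordered first: $\Lambda_1<\cdots<\Lambda_m$. Frequency order means that eigenspaces are ordered by decreasing absolute value of the eigenvalue; here the distinct eigenvalues in this order are $1,\ -\frac1{d-1},\ 0$ with multiplicities $1,\ d-1,\ d$, so the eigenspace of $0$ is last. A vertex subset $W$ with weights $(a_w)_{w\in W}$ averages an eigenspace $\Lambda$ if $\sum_{w\in W}a_w\phi(w)=\frac1n\sum_{v}\phi(v)$ for all $\phi\in\Lambda$. $W$ is a positively weighted extremal design if there are weights $a_w>0$ with which $W$ averages every one of $\Lambda_1,\dots,\Lambda_{m-1}$ (all but the last eigenspace), and a combinatorial one if the weights can be taken to be $a_w=1/|W|$. Minimal means inclusion-minimal among positively weighted extremal designs. *)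

(* Defs.v *)
From HB Require Import structures.
From mathcomp Require Import all_boot all_order all_algebra.
From mathcomp Require Import boolp classical_sets reals.

Set Implicit Arguments.
Unset Strict Implicit.
Unset Printing Implicit Defensive.

Import Order.TTheory GRing.Theory Num.Theory.
Local Open Scope ring_scope.

Section Polytopes.
Variables (R : realType) (d : nat).
Implicit Types S F P : set 'rV[R]_d.

Definition conv (V : finType) (p : V -> 'rV[R]_d) : set 'rV[R]_d :=
  fun x => exists a : V -> R,
    [/\ forall v, 0 <= a v, \sum_v a v = 1 & x = \sum_v a v *: p v].

(* The covector [c] represents the linear functional [x |-> x *m c]. *)
Definition is_face P F : Prop :=
  exists (c : 'cV[R]_d) (b : R),
    (forall x, P x -> (x *m c) 0 0 <= b) /\
    (forall x, F x <-> P x /\ (x *m c) 0 0 = b).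

(* The affine hull of [S] has dimension [k]: [S] is nonempty, and the row
   space of [U] is the linear span of the differences of points of [S]. *)
Definition has_dim S (k : nat) : Prop :=
  (exists x, S x) /\
  exists U : 'M[R]_d,
    [/\ \rank U = k,
        forall x y, S x -> S y -> (y - x <= U)%MS
      & forall W : 'M[R]_d,
          (forall x y, S x -> S y -> (y - x <= W)%MS) -> (U <= W)%MS].

Definition is_facet P F : Prop :=
  is_face P F /\ exists k, has_dim P k.+1 /\ has_dim F k.

(* Edge graph of [conv p], for a family [p] listing the vertices. *)
Definition edge_graph (V : finType) (p : V -> 'rV[R]_d) : rel V :=
  fun u v => (u != v) &&
    `[< exists F, [/\ is_face (conv p) F, has_dim F 1, F (p u) & F (p v)] >].

Definition is_facet_vertex_set (V : finType) (p : V -> 'rV[R]_d)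
    (W : {set V}) : Prop :=
  exists F, is_facet (conv p) F /\ forall v, v \in W <-> F (p v).

(* [(i, false)] stands for [e_i] and [(i, true)] for [- e_i]. *)
Definition cross_vertex (v : 'I_d * bool) : 'rV[R]_d :=
  (-1) ^+ v.2 *: delta_mx 0 v.1.

End Polytopes.

Section Designs.
Variables (R : realType) (V : finType).

(* A function [f] on [V] is encoded as the row vector with entries
   [f (enum_val i)]. The matrix is symmetric for an undirected graph, so the
   (left) eigenspaces of MathComp are the usual ones. *)
Definition normalized_adjacency (e : rel V) (delta : nat) : 'M[R]_#|V| :=
  delta%:R^-1 *: \matrix_(i, j) (e (enum_val i) (enum_val j))%:R.

(* The eigenspaces are listed through their eigenvalues. *)
Definition frequency_order (M : 'M[R]_#|V|) (s : seq R) : Prop :=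
  [/\ ohead s = Some 1,
      uniq s,
      forall a, (a \in s) = eigenvalue M a
    & sorted (fun a b => `|b| <= `|a|) s].

Variables (M : 'M[R]_#|V|) (s : seq R).

Definition averages (W : {set V}) (a : V -> R) (lambda : R) : Prop :=
  forall phi : 'rV[R]_#|V|, (phi <= eigenspace M lambda)%MS ->
    \sum_(w in W) a w * phi 0 (enum_rank w) =
    #|V|%:R^-1 * \sum_(v : V) phi 0 (enum_rank v).

Definition averages_all_but_last (W : {set V}) (a : V -> R) : Prop :=
  forall lambda, lambda \in take (size s).-1 s -> averages W a lambda.

Definition positive_extremal_design (W : {set V}) : Prop :=
  exists a : V -> R,
    (forall w, w \in W -> 0 < a w) /\ averages_all_but_last W a.

Definition combinatorial_extremal_design (W : {set V}) : Prop :=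
  averages_all_but_last W (fun=> #|W|%:R^-1).

Definition minimal_positive_extremal_designs : {set {set V}} :=
  [set W : {set V} |
    minset (fun B : {set V} => `[< positive_extremal_design B >]) W]%SET.

End Designs.

(* Main.v *)
Require Import Defs.
From mathcomp Require Import all_boot all_order all_algebra.
From mathcomp Require Import boolp reals.
From mathcomp Require Import ring lra.

Set Implicit Arguments.
Unset Strict Implicit.
Unset Printing Implicit Defensive.

Import Order.TTheory GRing.Theory Num.Theory.
Local Open Scope ring_scope.

(** The theorem holds because both the designs and the facets are the
    transversals of the antipodal pairs [{e_i, - e_i}], that is, the sets
    [{(-1)^(sigma i) e_i : i}] for the [2 ^ d] sign patterns [sigma].

    Facets. A functional [c] that attains its maximum over the cross-polytope at
    both [e_i] and [- e_i] vanishes, so a proper face contains at most one vertex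
    of each antipodal pair ([antipodal_face]).  A face that misses both vertices
    of some pair [i] lies in the coordinate hyperplane [x_i = 0] as well as in
    [c = b] with [b != 0], which leaves it too small to be a facet.  Conversely
    the functional [sum_i (-1)^(sigma i) x_i] exposes the transversal of
    [sigma] ([is_facet_vertex_set_crossP]).  The same first observation, with
    the functional [<p u + p v, _>] that exposes the edge [u v], shows that two
    vertices are adjacent exactly when they are neither equal nor antipodal
    ([edge_graph_crossE]).

    Designs. The normalized adjacency matrix maps [phi] to a function that is
    constant on antipodal pairs; hence every eigenvector for a nonzero eigenvalue
    is constant on the pairs.  In the other direction the functions constant on
    pairs are spanned by the constants (eigenvalue [1]) and the sum-zero ones
    (eigenvalue [- 1 / (d - 1)]).  Since [0] is an eigenvalue, frequency order
    puts it last, and averaging all the other eigenspaces means that the weights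
    on each antipodal pair add up to [1 / d] ([averages_all_but_lastP]).
    Positive weights of this kind exist exactly when the set meets every pair,
    and the minimal such sets are the transversals, on which the uniform weight
    [1 / d] works. *)

(** * Faces of convex hulls *)

Lemma sum_indicator (R : pzSemiRingType) (T : finType) (v : T) :
  \sum_w (w == v)%:R = 1 :> R.
Proof. by rewrite (bigD1 v) //= eqxx big1 ?addr0 // => w /negPf->. Qed.

Section ConvexHull.
Variables (R : realType) (d : nat) (V : finType) (p : V -> 'rV[R]_d).

Lemma conv_vertex v : conv p (p v).
Proof.
exists (fun w => (w == v)%:R); split=> [w||]; first exact: ler0n.
  exact: sum_indicator.
rewrite (bigD1 v) //= eqxx scale1r big1 ?addr0 // => w /negPf->.
by rewrite scale0r.
Qed.

Lemma mulmx_conv (a : V -> R) (c : 'cV[R]_d) :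
  ((\sum_v a v *: p v) *m c) 0 0 = \sum_v a v * (p v *m c) 0 0.
Proof.
rewrite mulmx_suml summxE; apply: eq_bigr => v _.
by rewrite -scalemxAl mxE.
Qed.

Lemma conv_le {c : 'cV[R]_d} {b x} :
  (forall v, (p v *m c) 0 0 <= b) -> conv p x -> (x *m c) 0 0 <= b.
Proof.
move=> cb [a [a0 a1 ->]]; rewrite mulmx_conv -[b]mul1r -a1 mulr_suml.
by apply: ler_sum => v _; apply: ler_wpM2l.
Qed.

(** The slack [b - c x] is the weighted sum of the nonnegative slacks of the
    vertices, so it vanishes only if every weighted vertex has slack [0]. *)
Lemma conv_face_support {c : 'cV[R]_d} {b x} :
    (forall v, (p v *m c) 0 0 <= b) -> conv p x -> (x *m c) 0 0 = b ->
  exists a : V -> R,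
    [/\ \sum_v a v = 1, x = \sum_v a v *: p v
      & forall v, (p v *m c) 0 0 != b -> a v = 0].
Proof.
move=> cb [a [a0 a1 ->]]; rewrite mulmx_conv => eqb.
exists a; split=> // v neb.
have s0 : \sum_v a v * (b - (p v *m c) 0 0) = 0.
  under eq_bigr do rewrite mulrBr.
  by rewrite sumrB -mulr_suml a1 mul1r eqb subrr.
have s_ge0 w : true -> 0 <= a w * (b - (p w *m c) 0 0).
  by move=> _; rewrite mulr_ge0 // subr_ge0.
have /eqP := psumr_eq0P s_ge0 s0 (isT : xpredT v).
by rewrite mulf_eq0 subr_eq0 (eq_sym b) (negPf neb) orbF => /eqP.
Qed.

Lemma is_face_exposed {c : 'cV[R]_d} {b} :
    (forall v, (p v *m c) 0 0 <= b) ->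
  is_face (conv p) (fun x => conv p x /\ (x *m c) 0 0 = b).
Proof. by move=> cb; exists c, b; split=> // x; apply: conv_le. Qed.

End ConvexHull.

Lemma mxrank_kermx_cV (R : fieldType) d (c : 'cV[R]_d) :
  c != 0 -> \rank (kermx c) = d.-1.
Proof.
move=> c0; rewrite mxrank_ker -mxrank_tr rank_rV -subn1; congr (_ - _)%N.
by rewrite -(inj_eq (@trmx_inj _ _ _)) trmxK trmx0 c0.
Qed.

Lemma level_kermx (R : fieldType) d (c : 'cV[R]_d) (x y : 'rV[R]_d) :
  (x *m c) 0 0 = (y *m c) 0 0 -> (y - x <= kermx c)%MS.
Proof.
move=> xyc; apply/sub_kermxP/matrixP => i j; rewrite !ord1 mulmxBl.
by rewrite [LHS]mxE [X in _ + X]mxE xyc subrr mxE.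
Qed.

(** * Faces of the cross-polytope *)

Section CrossPolytope.
Variables (R : realType) (d : nat).
Local Notation p := (@cross_vertex R d).
Local Notation V := ('I_d * bool)%type.

Lemma mul_cross_vertex v (c : 'cV[R]_d) :
  (p v *m c) 0 0 = (-1) ^+ v.2 * c v.1 0.
Proof. by rewrite -scalemxAl -rowE !mxE. Qed.

Lemma cross_vertexE v i : p v 0 i = (-1) ^+ v.2 * (i == v.1)%:R.
Proof. by rewrite !mxE. Qed.

Lemma cross_vertex_dot v w :
  (p w *m (p v)^T) 0 0 =
    if w == v then 1 else if w.1 == v.1 then -1 else 0.
Proof.
rewrite mul_cross_vertex mxE cross_vertexE.
case: v w => [i b] [j c]; rewrite /= xpair_eqE.
by case: eqP => _; case: b c => [] []; rewrite /= ?mulr0 //; ring.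
Qed.

Lemma cross_vertexN i b : p (i, ~~ b) = - p (i, b).
Proof. by rewrite /cross_vertex /=; case: b; rewrite !scaler_sign /= ?opprK. Qed.

Lemma cross_vertices_span (S : 'rV[R]_d -> Prop) (U : 'M[R]_d) :
    (forall v, S (p v)) -> (forall x y, S x -> S y -> (y - x <= U)%MS) ->
  (1%:M <= U)%MS.
Proof.
move=> Sp SU; apply/row_subP => i; rewrite row1.
have := SU _ _ (Sp (i, true)) (Sp (i, false)).
rewrite (cross_vertexN i false) opprK -mulr2n -scaler_nat.
by rewrite eqmx_scale ?pnatr_eq0 //  /cross_vertex /= scale1r.
Qed.

Lemma has_dim_full (S : 'rV[R]_d -> Prop) k :
  (forall v, S (p v)) -> has_dim S k -> k = d.
Proof.
move=> Sp [_ [U [<- SU _]]]; apply/eqP.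
by rewrite eqn_leq rank_leq_row -{1}(mxrank1 R d) mxrankS //
  (cross_vertices_span Sp).
Qed.

Lemma has_dim_cross_polytope : (0 < d)%N -> has_dim (conv p) d.
Proof.
move=> d0; split; first by exists (p (Ordinal d0, false)); apply: conv_vertex.
exists 1%:M; split=> [|x y _ _|W]; rewrite ?mxrank1 ?submx1 //.
by apply: cross_vertices_span => v; apply: conv_vertex.
Qed.

(** A functional maximized at both [p v] and [- p v] has maximum [0], hence
    vanishes identically by symmetry. *)
Lemma antipodal_face F i :
    is_face (conv p) F -> F (p (i, false)) -> F (p (i, true)) ->
  forall v, F (p v).
Proof.
move=> [c [b [cb FE]]] /FE[_ cf] /FE[_]; rewrite (cross_vertexN i false).
rewrite mulNmx mxE cf => bN [j e].
have := cb _ (conv_vertex p (j, ~~ e)); rewrite cross_vertexN mulNmx mxE.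
have := cb _ (conv_vertex p (j, e)) => h1 h2.
by apply/FE; split; [apply: conv_vertex | lra].
Qed.

(** The functional [<p u + p v, _>] is at most [1] on the vertices, with
    equality only at [u] and [v]. *)
Lemma edge_face u v : u.1 != v.1 ->
  exists F, [/\ is_face (conv p) F, has_dim F 1, F (p u) & F (p v)].
Proof.
move=> uv; pose c := (p u)^T + (p v)^T.
have cE w : (p w *m c) 0 0 = ((w == u) || (w == v))%:R
    - ((w != u) && (w.1 == u.1) || (w != v) && (w.1 == v.1))%:R.
  rewrite mulmxDr mxE !cross_vertex_dot.
  have [->|wu] := eqVneq w u.
    have [uv1|_] := eqVneq u v; first by rewrite uv1 eqxx in uv.
    by rewrite (negPf uv) /= subr0 addr0.
  have [->|wv] := eqVneq w v.
    by rewrite eq_sym (negPf uv) /= subr0 add0r.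
  have [wu1|_] := eqVneq w.1 u.1; first by rewrite wu1 (negPf uv) /= addr0 sub0r.
  by rewrite /= add0r sub0r; case: eqP => //; rewrite oppr0.
have cle w : (p w *m c) 0 0 <= 1.
  by rewrite cE; do 2 case: (_ || _); rewrite /=; lra.
have cu : (p u *m c) 0 0 = 1.
  by rewrite cE !eqxx /= (negPf uv) andbF subr0.
have cv : (p v *m c) 0 0 = 1.
  by rewrite cE !eqxx /= eq_sym in uv *; rewrite (negPf uv) orbT andbF subr0.
have cneq w : w != u -> w != v -> (p w *m c) 0 0 != 1.
  move=> /negPf wu /negPf wv; rewrite cE wu wv /= lt_eqF //.
  by case: (_ || _) => /=; lra.
have neuv : v != u by apply: contraNneq uv => ->.
exists (fun x => conv p x /\ (x *m c) 0 0 = 1).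
split; [exact: is_face_exposed| |by split=> //; apply: conv_vertex..].
split; first by exists (p u); split=> //; apply: conv_vertex.
have Fline x : conv p x /\ (x *m c) 0 0 = 1 ->
    exists t, x = p u + t *: (p v - p u).
  move=> [xP xc]; have [a [a1 -> a0]] := conv_face_support cle xP xc.
  exists (a v); move: a1.
  rewrite (bigD1 u) //= [\sum_(i | i != u) a i](bigD1 v) //=.
  rewrite big1 ?addr0 => [a1|w /andP[wu wv]]; last exact/a0/cneq.
  rewrite (bigD1 u) //= [\sum_(i | i != u) _](bigD1 v) //=.
  rewrite big1 ?addr0 => [|w /andP[wu wv]]; last by rewrite a0 ?scale0r ?cneq.
  rewrite scalerBr addrCA addrC; congr (_ + _).
  by rewrite -[a u](addrK (a v)) a1 scalerBl scale1r.
exists <<p v - p u>>%MS; split.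
- rewrite mxrank_gen rank_rV subr_eq0; apply/eqP; rewrite eqb1.
  apply/eqP => /(congr1 (fun x : 'rV[R]_d => (x *m (p v)^T) 0 0)).
  rewrite !cross_vertex_dot eqxx eq_sym (negPf neuv) (negPf uv).
  exact/eqP/oner_neq0.
- move=> x y /Fline[t ->] /Fline[t' ->]; rewrite genmxE.
  by rewrite opprD addrACA subrr add0r -scalerBl scalemx_sub.
- by move=> W FW; rewrite genmxE; apply: FW; split=> //; apply: conv_vertex.
Qed.

(** A face through two antipodal vertices is the whole polytope, whose dimension
    [d] exceeds that of an edge. *)
Lemma edge_graph_crossE u v : (2 <= d)%N ->
  edge_graph p u v = (u.1 != v.1).
Proof.
move=> d2; rewrite /edge_graph; have [uv1|uv1] /= := eqVneq u.1 v.1; last first.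
  by apply/andP; split; [apply: contraNneq uv1 => -> | apply/asboolP/edge_face].
apply/negP => /andP[uv /asboolP[F [faceF dimF Fu Fv]]].
suff /has_dim_full/(_ dimF) d1 : forall w, F (p w) by rewrite -d1 in d2.
apply: (@antipodal_face F u.1) => //; move: u v uv1 uv Fu Fv => [i b] [j b'] /= <-.
  by rewrite xpair_eqE eqxx; case: b b' => [] [].
by rewrite xpair_eqE eqxx; case: b b' => [] [].
Qed.

(** * Transversals of the antipodal pairs *)

Definition transversal (sigma : {ffun 'I_d -> bool}) : {set V} :=
  [set v : V | v.2 == sigma v.1]%SET.

Lemma card_transversal sigma : #|transversal sigma| = d.
Proof.
have -> : transversal sigma = [set (i, sigma i) | i : 'I_d]%SET.
  apply/setP => -[i b]; rewrite inE /=; apply/eqP/imsetP => [->|[j _ [-> ->]]] //.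
  by exists i.
by rewrite card_imset ?card_ord // => i j [].
Qed.

Lemma transversal_sub sigma tau :
  transversal sigma \subset transversal tau -> sigma = tau.
Proof.
move=> /fintype.subsetP st; apply/ffunP => i; apply/eqP.
by have := st (i, sigma i); rewrite !inE eqxx => /(_ isT).
Qed.

Lemma card_transversals : #|[set transversal sigma | sigma in setT]%SET| = (2 ^ d)%N.
Proof.
rewrite card_imset => [|sigma tau st].
  by rewrite cardsT card_ffun card_bool card_ord.
by apply: transversal_sub; rewrite st.
Qed.

Definition meets_all_pairs (W : {set V}) := [forall i, exists b, (i, b) \in W].

Lemma minset_meets_all_pairsP W :
  reflect (exists sigma, W = transversal sigma) (minset meets_all_pairs W).
Proof.
have trP sigma : meets_all_pairs (transversal sigma).
  by apply/forallP => i; apply/existsP; exists (sigma i); rewrite inE.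
have subP B : meets_all_pairs B -> exists sigma, transversal sigma \subset B.
  move=> /forallP/(_ _)/existsP BP; exists [ffun i => xchoose (BP i)].
  apply/fintype.subsetP => -[i b]; rewrite inE ffunE /= => /eqP->.
  exact: (xchooseP (BP i)).
apply: (iffP minsetP) => [[Wm Wmin]|[sigma ->]].
  by have [sigma sW] := subP W Wm; exists sigma; rewrite (Wmin _ (trP _) sW).
split=> // B /subP[tau tB] Bs; apply/eqP; rewrite eqEsubset Bs.
by rewrite -(transversal_sub (fintype.subset_trans tB Bs)).
Qed.

(** * Facets of the cross-polytope *)

(** The functional [x |-> sum_i (-1)^(sigma i) x_i] exposes the transversal. *)
Lemma transversal_is_facet sigma : (0 < d)%N ->
  is_facet_vertex_set p (transversal sigma).
Proof.
move=> d0; pose c : 'cV[R]_d := \col_i (-1) ^+ sigma i.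
have cE v : (p v *m c) 0 0 = if v.2 == sigma v.1 then 1 else -1.
  rewrite mul_cross_vertex mxE -signr_addb.
  by case: v.2 (sigma _) => [] [] /=; rewrite ?expr0 ?expr1.
have cle v : (p v *m c) 0 0 <= 1 by rewrite cE; case: ifP => _; lra.
have c1 v : v.2 == sigma v.1 <-> (p v *m c) 0 0 = 1.
  by rewrite cE; case: ifP => //; split=> // ?; exfalso; lra.
pose F x := conv p x /\ (x *m c) 0 0 = 1.
have Fp i : F (p (i, sigma i)).
  by split; [apply: conv_vertex | apply/c1].
exists F; split; last first.
  move=> v; rewrite inE; split=> [/c1|[_ /c1]] //.
  by split=> //; apply: conv_vertex.
split; first exact: is_face_exposed.
exists d.-1; rewrite prednK //; split; first exact: has_dim_cross_polytope.
pose i0 := Ordinal d0.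
split; first by exists (p (i0, sigma i0)).
exists (kermx c); split.
- apply: mxrank_kermx_cV; apply/eqP => /matrixP/(_ i0 0)/eqP.
  by rewrite !mxE signr_eq0.
- by move=> x y [_ xc] [_ yc]; apply: level_kermx; rewrite xc yc.
move=> U FU; apply/rV_subP => v /sub_kermxP/matrixP/(_ 0 0).
rewrite !mxE => vc.
(* The coefficients of [v] on the transversal add up to [0], so subtracting
   the fixed vertex [i0] from every term does not change the sum. *)
have -> : v = \sum_i (v 0 i * c i 0) *: (p (i, sigma i) - p (i0, sigma i0)).
  under [RHS]eq_bigr do rewrite scalerBr.
  rewrite sumrB -scaler_suml vc scale0r subr0 [LHS]row_sum_delta.
  apply: eq_bigr => i _; rewrite /cross_vertex scalerA mxE /= -mulrA.
  by rewrite -signr_addb addbb mulr1.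
by apply: summx_sub => i _; apply: scalemx_sub; apply: FU.
Qed.

(** If the face [c = b] avoids [e_i] and [- e_i], it lies in the hyperplane
    [x_i = 0].  Were it of dimension [d - 1], its direction space would be both
    [ker c] and contained in [x_i = 0]; together with a point of the face, which
    is not in [ker c], it would span the whole space inside [x_i = 0]. *)
Lemma facet_meets_pair F i :
  is_face (conv p) F -> has_dim F d.-1 -> exists b, F (p (i, b)).
Proof.
move=> [c [b [cb FE]]] [[x0 Fx0] [U [rU FU minU]]]; apply: contrapT => noF.
have notF e : ~ F (p (i, e)) by move=> Fe; apply: noF; exists e.
have cp v : (p v *m c) 0 0 <= b by apply/cb/conv_vertex.
have b0 : b != 0.
  apply/eqP => b0; apply: (notF false); apply/FE; split; first exact: conv_vertex.
  have := cp (i, true); rewrite (cross_vertexN i false) mulNmx mxE b0.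
  by have := cp (i, false); rewrite b0; lra.
have Fi x : F x -> x 0 i = 0.
  move=> /FE[xP xc]; have [a [_ -> a0]] := conv_face_support cp xP xc.
  rewrite summxE big1 // => -[j e] _; rewrite mxE cross_vertexE /=.
  have [ij|_] := eqVneq i j; last by rewrite !mulr0.
  rewrite a0 ?mul0r // -ij; apply/eqP => ce.
  by apply: (notF e); apply/FE; split=> //; apply: conv_vertex.
have x0c : (x0 *m c) 0 0 = b by have [] := (FE x0).1 Fx0.
have c0 : c != 0.
  by apply: contra_neq b0 => c0; rewrite -x0c c0 mulmx0 mxE.
have Uc : (U <= kermx c)%MS.
  by apply: minU => x y /FE[_ xc] /FE[_ yc]; apply: level_kermx; rewrite xc yc.
have Ui : (U <= kermx (delta_mx i 0 : 'cV[R]_d))%MS.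
  by apply: minU => x y Fx Fy; apply: level_kermx; rewrite -!colE !mxE !Fi.
have cU : (kermx c <= U)%MS.
  by rewrite -(mxrank_leqif_sup Uc) rU mxrank_kermx_cV.
pose v : 'rV[R]_d := delta_mx 0 i - (c i 0 / b) *: x0.
have : (v <= kermx c)%MS.
  by apply: level_kermx; rewrite -rowE -scalemxAl [LHS]mxE x0c divfK // mxE.
move=> /submx_trans/(_ cU)/submx_trans/(_ Ui)/sub_kermxP.
rewrite -colE => /matrixP/(_ 0 0)/eqP.
by rewrite !mxE Fi // !eqxx mulr0 subr0 oner_eq0.
Qed.

Lemma is_facet_vertex_set_crossP W : (0 < d)%N ->
  is_facet_vertex_set p W <-> exists sigma, W = transversal sigma.
Proof.
move=> d0; split=> [|[sigma ->]]; last exact: transversal_is_facet.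
move=> [F [[faceF [k [dimP dimF]]] WF]].
have dk : k.+1 = d by apply: has_dim_full dimP => v; apply: conv_vertex.
have not2 i : F (p (i, false)) -> F (p (i, true)) -> False.
  move=> Ff Ft; have := has_dim_full (antipodal_face faceF Ff Ft) dimF.
  by rewrite -dk => /esym/eqP; rewrite gtn_eqF.
have kE : k = d.-1 by rewrite -dk.
rewrite kE in dimF.
have Wneg i : ((i, false) \in W) = ~~ ((i, true) \in W).
  apply/idP/idP => [/WF Ff|]; first by apply/negP => /WF Ft; apply: (not2 i).
  have [[] /WF iW] := facet_meets_pair i faceF dimF; last by [].
  by rewrite iW.
exists [ffun i => (i, true) \in W]; apply/setP => -[i b]; rewrite inE ffunE /=.
by case: b; rewrite ?Wneg; case: ((i, true) \in W).
Qed.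

End CrossPolytope.

(** * Eigenvectors of the cocktail party graph *)

Section Eigenvectors.
Variables (R : realType) (d : nat) (hd : (2 <= d)%N).
Local Notation V := ('I_d * bool)%type.
Local Notation p := (@cross_vertex R d).
Local Notation M := (normalized_adjacency R (edge_graph p) (2 * d.-1)).

Lemma sum_pairs (P : pred 'I_d) (f : V -> R) :
  \sum_(v | P v.1) f v = \sum_(i | P i) (f (i, true) + f (i, false)).
Proof.
rewrite (eq_bigl (fun v : V => P v.1 && true)) => [|v]; last by rewrite andbT.
rewrite (eq_bigr (fun v : V => f (v.1, v.2))) => [|[]] //.
rewrite -(pair_big P xpredT (fun i b => f (i, b))) /=.
by apply: eq_bigr => i _; rewrite big_bool.
Qed.

Lemma mul_adjacency (phi : 'rV[R]_#|{: V}|) v :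
  (phi *m M) 0 (enum_rank v) =
    (2 * d.-1)%:R^-1 * \sum_(u | u.1 != v.1) phi 0 (enum_rank u).
Proof.
rewrite mxE (reindex enum_rank) /=; last exact/onW_bij/enum_rank_bij.
rewrite [in RHS]big_mkcond mulr_sumr /=; apply: eq_bigr => u _.
rewrite !mxE !enum_rankK edge_graph_crossE //.
by case: eqP => /= _; ring.
Qed.

Definition row_of (f : V -> R) : 'rV[R]_#|{: V}| := \row_j f (enum_val j).

Lemma row_ofE f v : row_of f 0 (enum_rank v) = f v.
Proof. by rewrite mxE enum_rankK. Qed.

Lemma row_of_eigenspace f lambda :
    (forall v, \sum_(u | u.1 != v.1) f u = (2 * d.-1)%:R * (lambda * f v)) ->
  (row_of f <= eigenspace M lambda)%MS.
Proof.
move=> fE; apply/eigenspaceP/rowP => j; rewrite -(enum_valK j) mul_adjacency.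
under eq_bigr do rewrite row_ofE.
rewrite fE mulKf ?mxE ?enum_rankK // pnatr_eq0 muln_eq0 /=.
by case: d hd => [|[]].
Qed.

Lemma dm1_gt0 : 0 < d.-1%:R :> R.
Proof. by rewrite ltr0n; case: d hd => [|[]]. Qed.

Lemma sum_zero_eigenspace (g : 'I_d -> R) : \sum_i g i = 0 ->
  (row_of (fun v => g v.1) <= eigenspace M (- d.-1%:R^-1))%MS.
Proof.
move=> g0; apply: row_of_eigenspace => v.
rewrite (sum_pairs (fun i => i != v.1)) big_split /= -mulr2n.
have := dm1_gt0; move: g0; rewrite (bigD1 v.1) //= => /eqP.
rewrite addrC addr_eq0 => /eqP-> d0.
by rewrite natrM; field; rewrite gt_eqF.
Qed.

Lemma const_eigenspace : (row_of (fun=> 1) <= eigenspace M 1)%MS.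
Proof.
apply: row_of_eigenspace => v.
rewrite (sum_pairs (fun i => i != v.1)) sumr_const cardC1 card_ord.
by rewrite -mulr_natl natrM; ring.
Qed.

Lemma eigenvalue0 : eigenvalue M 0.
Proof.
have d0 : (0 < d)%N by apply: ltnW.
pose i0 := Ordinal d0.
pose f (v : V) : R := (v.1 == i0)%:R * (-1) ^+ v.2.
have /eigenspaceP fE : (row_of f <= eigenspace M 0)%MS.
  apply: row_of_eigenspace => v; rewrite (sum_pairs (fun i => i != v.1)).
  by rewrite big1 => [|i _]; rewrite /f /=; ring.
apply/eigenvalueP; exists (row_of f) => //.
apply/eqP => /matrixP/(_ 0 (enum_rank (i0, false)))/eqP.
by rewrite row_ofE mxE /f eqxx expr0 mulr1 oner_eq0.
Qed.

(** [phi *m M] at a vertex only depends on the antipodal pair of the vertex. *)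
Lemma eigenvector_pairs (phi : 'rV[R]_#|{: V}|) lambda v :
    lambda != 0 -> (phi <= eigenspace M lambda)%MS ->
  phi 0 (enum_rank v) = phi 0 (enum_rank (v.1, false)).
Proof.
move=> l0 /eigenspaceP phiE.
have eqM u : lambda * phi 0 (enum_rank u) = (phi *m M) 0 (enum_rank u).
  by rewrite phiE mxE.
by apply: (mulfI l0); rewrite !eqM !mul_adjacency.
Qed.

(** * Designs of the cocktail party graph *)

Section Designs.
Variables (s : seq R) (hs : frequency_order M s).

(** [0] is an eigenvalue, and nothing has smaller absolute value. *)
Lemma mem_all_but_last lambda :
  (lambda \in take (size s).-1 s) = (lambda != 0) && eigenvalue M lambda.
Proof.
case: hs => _ us sE srt; rewrite -sE.
have := eigenvalue0; rewrite -sE => s0.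
case/lastP: s us s0 srt => [//|t x] us s0 srt.
have x0 : x = 0.
  move: s0; rewrite mem_rcons inE => /orP[/eqP->//|t0].
  move: srt; rewrite sorted_pairwise => [|a b c ba cb]; last exact: le_trans cb ba.
  rewrite pairwise_rcons => /andP[/allP/(_ 0 t0) /=].
  by rewrite normr0 normr_le0 => /eqP.
rewrite size_rcons /= -cats1 take_size_cat // mem_cat !inE x0.
move: us; rewrite rcons_uniq x0 => /andP[t0 _].
by have [->|] := eqVneq lambda 0; rewrite ?(negPf t0) ?orbF.
Qed.

(** When [lambda] is not an eigenvalue its eigenspace is zero and averaging it
    is vacuous, so the condition can range over all nonzero reals. *)
Lemma averages_all_but_lastE W a :
  averages_all_but_last M s W a <->
    (forall lambda, lambda != 0 -> averages M W a lambda).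
Proof.
split=> av lambda; last by rewrite mem_all_but_last => /andP[/av].
move=> l0; have [ev|] := boolP (eigenvalue M lambda).
  by apply: av; rewrite mem_all_but_last l0.
move=> /negPn/eqP ker0 phi; rewrite ker0 submx0 => /eqP->.
by rewrite !big1 ?mulr0 // => w _; rewrite mxE ?mulr0.
Qed.

Let card_V : #|{: V}| = (2 * d)%N.
Proof. by rewrite card_prod card_ord card_bool mulnC. Qed.

Let d_neq0 : d%:R != 0 :> R.
Proof. by rewrite pnatr_eq0; case: d hd. Qed.

Lemma averages_all_but_lastP W a :
  averages_all_but_last M s W a <->
    (forall i, \sum_(w in W | w.1 == i) a w = d%:R^-1).
Proof.
rewrite averages_all_but_lastE; split=> [av i|aW lambda l0 phi phiE].
- (* The constants fix the total weight, and the sum-zero function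
     [[v.1 == i] - 1 / d] then fixes the weight of the pair [i]. *)
  have /(_ _ const_eigenspace) := av 1 (oner_neq0 R).
  under eq_bigr do rewrite row_ofE mulr1.
  under [X in _ * X]eq_bigr do rewrite row_ofE.
  rewrite sumr_const card_V mulVf; last first.
    by rewrite natrM mulf_neq0 // pnatr_eq0.
  move=> a1.
  pose g j : R := (j == i)%:R - d%:R^-1.
  have g0 : \sum_j g j = 0.
    rewrite sumrB sum_indicator sumr_const card_ord.
    by rewrite -[_ *+ d]mulr_natr mulVf // subrr.
  have ldm1 : - d.-1%:R^-1 != 0 :> R by rewrite oppr_eq0 invr_eq0 gt_eqF // dm1_gt0.
  have /(_ _ (sum_zero_eigenspace g0)) := av _ ldm1.
  under eq_bigr do rewrite row_ofE.
  under [X in _ * X]eq_bigr do rewrite row_ofE.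
  rewrite (sum_pairs xpredT) big_split /= g0 addr0 mulr0 /g.
  under eq_bigr do rewrite mulrBr.
  rewrite sumrB -mulr_suml a1 mul1r => /eqP; rewrite subr_eq0 => /eqP <-.
  rewrite big_mkcondr; apply: eq_bigr => w _.
  by case: eqP; rewrite ?mulr1 ?mulr0.
pose g i := phi 0 (enum_rank (i, false)).
have phig v : phi 0 (enum_rank v) = g v.1 by apply: eigenvector_pairs phiE.
under eq_bigr do rewrite phig.
under [X in _ * X]eq_bigr do rewrite phig.
rewrite (sum_pairs xpredT) big_split /= card_V.
rewrite (partition_big (fun w : V => w.1) xpredT) //=.
transitivity (\sum_i d%:R^-1 * g i).
  apply: eq_bigr => i _; rewrite -(aW i) mulr_suml.
  by apply: eq_bigr => w /andP[_ /eqP->].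
by rewrite -mulr_sumr natrM; field.
Qed.

Lemma positive_extremal_designE W :
  positive_extremal_design M s W <-> meets_all_pairs W.
Proof.
split=> [[a [_ /averages_all_but_lastP aW]]|/forallP WP].
  apply/forallP => i; apply: contraT => /existsPn noi.
  have := aW i; rewrite big1 => [/esym/eqP|[j b] /andP[jW /eqP/= ij]].
    by rewrite invr_eq0 (negPf d_neq0).
  by have := noi b; rewrite -ij jW.
(* The weight [1 / d] of a pair is shared equally by its vertices in [W]. *)
pose m i := #|[pred w in W | w.1 == i]|.
have m0 i : (0 < m i)%N.
  by have /existsP[b ib] := WP i; apply/card_gt0P; exists (i, b); rewrite !inE ib /=.
exists (fun w => (d%:R * (m w.1)%:R)^-1); split=> [w _|].
  by rewrite invr_gt0 mulr_gt0 ?ltr0n ?m0 // ltnW.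
apply/averages_all_but_lastP => i.
rewrite (eq_bigr (fun=> (d%:R * (m i)%:R)^-1)) => [|w /andP[_ /eqP->]] //.
rewrite sumr_const -/(m i) -mulr_natr; field.
by rewrite d_neq0 pnatr_eq0 -lt0n m0.
Qed.

Lemma minimal_designsP W :
  reflect (exists sigma, W = transversal sigma)
    (W \in minimal_positive_extremal_designs M s).
Proof.
rewrite inE; suff -> : minset (fun B => `[< positive_extremal_design M s B >]) W
    = minset (@meets_all_pairs d) W by apply: minset_meets_all_pairsP.
apply: minset_eq => B; by apply/asboolP/idP => /positive_extremal_designE.
Qed.

Lemma transversal_combinatorial sigma :
  combinatorial_extremal_design M s (transversal sigma).
Proof.
apply/averages_all_but_lastP => i; rewrite card_transversal.
rewrite (big_pred1 (i, sigma i)) // => -[j b]; rewrite inE /= xpair_eqE andbC.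
by case: eqP => // ->.
Qed.

End Designs.
End Eigenvectors.

Theorem theorem4p1 (R : realType) (d : nat) (hd : (2 <= d)%N) (s : seq R)
    (hs : frequency_order
            (normalized_adjacency R (edge_graph (@cross_vertex R d))
               (2 * d.-1)) s) :
  let M := normalized_adjacency R (edge_graph (@cross_vertex R d))
             (2 * d.-1) in
  let designs := minimal_positive_extremal_designs M s in
  [/\ #|designs| = (2 ^ d)%N,
      forall W, W \in designs -> #|W| = d,
      forall W, W \in designs <-> is_facet_vertex_set (@cross_vertex R d) W
    & forall W, W \in designs -> combinatorial_extremal_design M s W].
Proof.
move=> M designs; have designsP := minimal_designsP hd hs.
split=> [|W /designsP[sigma ->]|W|W /designsP[sigma ->]].
- rewrite -card_transversals; apply: eq_card => W.
  apply/designsP/imsetP => [[sigma ->]|[sigma _ ->]]; last by exists sigma.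
  by exists sigma; rewrite ?inE.
- exact: card_transversal.
- by rewrite is_facet_vertex_set_crossP ?(ltnW hd) //; split=> /designsP.
- exact: transversal_combinatorial.
Qed.
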